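(* Let $X$ be a $C^2$ planar vector field with $X(p)=0$ and $DX(p)$ nilpotent of rank one, and let $q_0$ span $\ker DX(p)$. Let $\varphi$ be a $C^{2}$ diffeomorphism with $\varphi(z_{0})=p$, let $Y:=(D\varphi)^{-1}\,X\circ\varphi$, and put $q_0^z:=D\varphi(z_0)^{-1}q_0$. Then $$\langle\nabla(\operatorname{tr}DY)(z_{0}),\,q_{0}^{z}\rangle=\langle\nabla(\operatorname{tr}DX)(p),\,q_{0}\rangle,\qquad \langle\nabla(\det DY)(z_{0}),\,q_{0}^{z}\rangle=\langle\nabla(\det DX)(p),\,q_{0}\rangle .$$
   Context: $\operatorname{tr}DX$ and $\det DX$ denote the functions $z\mapsto\operatorname{tr}DX(z)$, $z\mapsto\det DX(z)$, and similarly for $Y$. *)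

(* Defs.v *)
From HB Require Import structures.
From mathcomp Require Import all_boot all_order all_algebra.
From mathcomp Require Import all_classical all_reals all_analysis.
Import Order.TTheory GRing.Theory Num.Theory.
Import numFieldNormedType.Exports.

Set Implicit Arguments.
Unset Strict Implicit.
Unset Printing Implicit Defensive.

Local Open Scope classical_set_scope.
Local Open Scope ring_scope.

(* Points and vectors of the plane are row vectors, so that 'J f z is the
   transpose of the usual matrix of Df(z): it acts by v |-> v *m 'J f z, and
   Df(z)^-1 acts by v |-> v *m invmx ('J f z). *)

(* Meant for finite-dimensional E and an open set U: the directional
   derivatives of f are then linear combinations of its partial derivatives,
   and this is the usual class C^k. *)
Fixpoint Ck (R : realType) (E F : normedModType R) (k : nat) (U : set E)
    (f : E -> F) : Prop :=
  if k is k'.+1 then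
    (forall x, U x -> differentiable f x) /\ (forall v, Ck k' U ('D_v f))
  else forall x, U x -> {for x, continuous f}.

Definition Ck_diffeo (R : realType) (E F : normedModType R) (k : nat)
    (V : set E) (W : set F) (f : E -> F) : Prop :=
  [/\ open V, open W, Ck k V f, f @` V = W &
      exists g : F -> E, Ck k W g /\ forall x, V x -> g (f x) = x].

Definition nilpotent_mx (R : realType) (n : nat) (A : 'M[R]_n.+1) : Prop :=
  exists k : nat, A ^+ k = 0.

Definition dotv (R : realType) (n : nat) (u v : 'rV[R]_n) : R :=
  \sum_i u 0 i * v 0 i.

Definition grad (R : realType) (n : nat) (f : 'rV[R]_n.+1 -> R)
    (z : 'rV[R]_n.+1) : 'rV[R]_n.+1 :=
  \row_i 'D_(delta_mx 0 i) f z.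

Definition trD (R : realType) (n : nat) (X : 'rV[R]_n.+1 -> 'rV[R]_n.+1)
    (z : 'rV[R]_n.+1) : R := \tr ('J X z).

Definition detD (R : realType) (n : nat) (X : 'rV[R]_n.+1 -> 'rV[R]_n.+1)
    (z : 'rV[R]_n.+1) : R := \det ('J X z).

Definition pullback_field (R : realType) (n : nat)
    (phi X : 'rV[R]_n.+1 -> 'rV[R]_n.+1) (z : 'rV[R]_n.+1) : 'rV[R]_n.+1 :=
  X (phi z) *m invmx ('J phi z).

(* Main.v *)
(* On V the inverse of D phi is Dg o phi with g = phi^-1, so Y = (X Dg) o phi
   and, for row vectors, JY = J phi . (JX o phi) . (Jg o phi) + C, where the
   entries of C are linear combinations of the components of X o phi. Since
   the second derivatives of g are merely continuous, C need not be
   differentiable elsewhere, but X o phi vanishes at z0, and a differentiable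
   function vanishing at z0 times a continuous one is differentiable at z0.
   Its derivative along q0z is a multiple of that of X o phi, hence of q0 JX(p),
   which is zero. Calling two functions congruent when their difference vanishes
   at z0 together with its derivative along q0z, the entries of JY are thus
   congruent to those of a matrix with the trace and determinant of JX o phi;
   congruence between functions continuous at z0 is stable under sums and
   products, hence passes to traces and determinants. *)
Require Import Defs.
From HB Require Import structures.
From mathcomp Require Import all_boot all_order all_algebra.
From mathcomp Require Import all_classical all_reals all_analysis.
Import Order.TTheory GRing.Theory Num.Theory.
Import numFieldNormedType.Exports.

Set Implicit Arguments.
Unset Strict Implicit.
Unset Printing Implicit Defensive.

Local Open Scope classical_set_scope.
Local Open Scope ring_scope.

(** * First-order expansions and products with a vanishing factor *)

Lemma is_diff_eqaddo (R : numFieldType) (E F : normedModType R) (f : E -> F)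
    (df : {linear E -> F}) (x : E) :
  continuous df -> f \o shift x = cst (f x) + df +o_ 0 id -> is_diff x f df.
Proof.
move=> dfc fE; have dfE := diff_unique dfc fE.
by apply: DiffDef => //; apply/diff_locallyP; rewrite dfE.
Qed.

(** A first-order expansion sees only values near [x]. This lets identities that hold merely on a
    neighbourhood be differentiated. *)
Lemma near_eq_is_diff (R : numFieldType) (E F : normedModType R) (f g : E -> F)
    (df : E -> F) (x : E) :
  {near x, f =1 g} -> is_diff x f df -> is_diff x g df.
Proof.
move=> fg [dfx <-]; apply: is_diff_eqaddo; first exact: diff_continuous.
have /diff_locally/eqaddoP fo := dfx; apply/eqaddoP => e /fo.
have fgx := nbhs_singleton fg; move: fg; rewrite (near_shift 0 x) => fg.
apply: filter_app; move: fg; apply: filter_app.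
by near=> h; rewrite /= subr0 !fctE fgx /= => ->.
Unshelve. all: by end_near. Qed.

(** Differentiability and [f x = 0] make [f (h + x)] of order [|h|], while continuity makes
    [g (h + x)] tend to 0; the product is therefore o(h). *)
Lemma is_diff_mul00 (R : numFieldType) (E : normedModType R) (f g : E -> R)
    (x : E) :
  differentiable f x -> f x = 0 -> {for x, continuous g} -> g x = 0 ->
  is_diff x (f * g) 0.
Proof.
move=> dfx fx0 gc gx0.
apply: (@is_diff_eqaddo _ _ _ _ \0) => /=; first exact: cst_continuous.
apply/eqaddoP => _/posnumP[e].
have /linear_lipschitz[k k0 dfk] := diff_continuous dfx.
have /diff_locally/eqaddoP/(_ 1 ltr01) := dfx; apply: filter_app.
have k1 : 0 < k + 1 by rewrite addr_gt0.
(* The differential contributes at most [k * |h|] and the remainder, taken with tolerance 1, at most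
   [|h|]. Hence the factor [k + 1], which the bound on [g] has to compensate. *)
have ek : 0 < e%:num / (k + 1) by rewrite divr_gt0.
move/cvgrPdist_le/(_ _ ek) : gc; rewrite gx0 near_simpl (near_shift 0 x).
apply: filter_app; near=> h => /=; rewrite subr0 sub0r normrN !fctE /= fx0.
rewrite mul0r !add0r subr0 mul1r => gh fh; rewrite normrM.
have fk : `|f (h + x)| <= (k + 1) * `|h|.
  rewrite -[f _](subrK ('d f x h)) (le_trans (ler_normD _ _))//.
  by rewrite addrC mulrDl mul1r lerD.
rewrite (le_trans (ler_pM _ _ fk gh))// mulrAC mulrCA divff ?gt_eqF//.
by rewrite mulr1.
Unshelve. all: by end_near. Qed.

(** Splitting [g] into [g - g x] and the constant [g x] leaves a product of two functions vanishing
    at [x], with zero differential, and a multiple of [f]. *)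
Lemma is_diff_mul0 (R : numFieldType) (E : normedModType R) (f g : E -> R)
    (x : E) :
  differentiable f x -> f x = 0 -> {for x, continuous g} ->
  is_diff x (f * g) (g x *: ('d f x : E -> R)).
Proof.
move=> dfx fx0 gx.
have -> : f * g = f * (g - cst (g x)) + g x *: f.
  apply/funext => y; rewrite !fctE -[g x *: _]/(g x * _).
  by rewrite mulrBr [g x * _]mulrC subrK.
have -> : g x *: ('d f x : E -> R) = 0 + g x *: ('d f x : E -> R).
  by rewrite add0r.
apply: is_diffD; last by apply: is_diffZ; exact: differentiableP.
apply: is_diff_mul00 => //; last by rewrite !fctE subrr.
by apply: continuousB => //; exact: cst_continuous.
Qed.

(** * Classes C^k, coordinates and Jacobian entries *)

Lemma Ck_eq (R : realType) (E F : normedModType R) (k : nat) (U : set E)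
    (f g : E -> F) :
  open U -> (forall x, U x -> f x = g x) -> Ck k U f -> Ck k U g.
Proof.
move=> Uo; elim: k f g => [|k IH] f g fg /=.
  move=> fc x Ux; rewrite /prop_for /continuous_at -fg//.
  apply: cvg_trans (fc x Ux); apply: near_eq_cvg.
  by apply: filterS (open_nbhs_nbhs (conj Uo Ux)) => y Uy; rewrite fg.
have nearfg x : U x -> {near x, f =1 g}.
  by move=> Ux; apply: filterS (open_nbhs_nbhs (conj Uo Ux)) => y Uy; exact: fg.
case=> fd fD; split=> [x Ux|v].
  by have /differentiableP := fd x Ux => /(near_eq_is_diff (nearfg x Ux))[].
by apply: IH (fD v) => x Ux; exact/near_eq_derive/nearfg.
Qed.

Lemma Ck_coord (R : realType) (E : normedModType R) (m n k : nat) (U : set E)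
    (f : E -> 'M[R]_(m.+1, n.+1)) i j :
  open U -> Ck k U f -> Ck k U (fun x => f x i j).
Proof.
move=> Uo; elim: k f => [|k IH] f /=.
  move=> fc x Ux; apply: (@continuous_comp _ _ _ f (fun M => M i j)).
      exact: fc.
    exact: coord_continuous.
case=> fd fD; split=> [x Ux|v].
  apply: (@differentiable_comp _ _ _ _ f (fun M => M i j)); first exact: fd.
  exact: differentiable_coord.
apply: Ck_eq (IH _ (fD v)) => // x Ux.
by rewrite derive_mx ?mxE//; exact/diff_derivable/fd.
Qed.

Lemma jacobianE (R : realType) (m n : nat) (f : 'rV[R]_m.+1 -> 'rV[R]_n.+1)
    (x : 'rV[R]_m.+1) i j :
  differentiable f x -> 'J f x i j = 'D_(delta_mx 0 i) f x 0 j.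
Proof. by move=> fd; rewrite deriveE// mxE. Qed.

Lemma Ck_jacobian (R : realType) (m n k : nat) (U : set 'rV[R]_m.+1)
    (f : 'rV[R]_m.+1 -> 'rV[R]_n.+1) i j :
  open U -> Ck k.+1 U f -> Ck k U (fun x => 'J f x i j).
Proof.
move=> Uo [fd fD].
apply: Ck_eq (Ck_coord 0 j Uo (fD (delta_mx 0 i))) => // x Ux.
by rewrite jacobianE//; exact: fd.
Qed.

Lemma Ck_continuous (R : realType) (E F : normedModType R) (k : nat)
    (U : set E) (f : E -> F) (x : E) :
  Ck k U f -> U x -> {for x, continuous f}.
Proof.
case: k => [fc /fc//|k [fd _] /fd]; exact: differentiable_continuous.
Qed.

(** * Differentials in coordinates and gradients *)

Lemma diff_mulmx_jacobian (R : realType) (m n : nat)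
    (f : 'rV[R]_m.+1 -> 'rV[R]_n.+1) (x v : 'rV[R]_m.+1) :
  'd f x v = v *m 'J f x.
Proof. by rewrite mul_rV_lin1. Qed.

Lemma differentiable_coordf (R : realType) (E : normedModType R) (m n : nat)
    (f : E -> 'M[R]_(m.+1, n.+1)) (x : E) i j :
  differentiable f x -> differentiable (fun y => f y i j) x.
Proof.
move=> fd; apply: (@differentiable_comp _ _ _ _ f (fun M => M i j)) => //.
exact: differentiable_coord.
Qed.

Lemma diff_coord (R : realType) (m n : nat) (E : normedModType R)
    (f : E -> 'M[R]_(m.+1, n.+1)) (x v : E) i j :
  differentiable f x -> 'd (fun y => f y i j) x v = 'd f x v i j.
Proof.
move=> fd.
have fijd := differentiable_coordf i j fd.
by rewrite -!deriveE// derive_mx ?mxE//; exact: diff_derivable.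
Qed.

Lemma dotv_grad (R : realType) (n : nat) (f : 'rV[R]_n.+1 -> R)
    (x v : 'rV[R]_n.+1) :
  differentiable f x -> dotv (grad f x) v = 'd f x v.
Proof.
move=> fd; rewrite [in RHS](row_sum_delta v) linear_sum; apply: eq_bigr => i _.
by rewrite linearZ mxE deriveE// mulrC.
Qed.

Lemma differentiable_rV (R : realType) (E : normedModType R) (n : nat)
    (f : E -> 'rV[R]_n.+1) (x : E) :
  (forall j, differentiable (fun y => f y 0 j) x) -> differentiable f x.
Proof.
move=> fd; rewrite (_ : f = \sum_j (fun y => f y 0 j *: delta_mx 0 j)).
  by apply: differentiable_sum => j; exact: differentiableZl.
by apply/funext => y; rewrite fct_sumE; exact: row_sum_delta.
Qed.

(** * Flat functions and congruence at a point along a direction *)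

Definition flat_at (R : realType) (E : normedModType R) (z w : E)
    (f : E -> R) :=
  [/\ differentiable f z, f z = 0 & 'd f z w = 0].

Lemma flat_at0 (R : realType) (E : normedModType R) (z w : E) :
  flat_at z w 0.
Proof.
split; [exact: (differentiable_cst (0 : R) z)|by []|].
exact: (congr1 (fun h : E -> R => h w) (diff_cst (0 : R) z)).
Qed.

Lemma flat_atD (R : realType) (E : normedModType R) (z w : E) (f g : E -> R) :
  flat_at z w f -> flat_at z w g -> flat_at z w (f + g).
Proof.
move=> [fd f0 fw] [gd g0 gw]; split; first exact: differentiableD.
  by rewrite fctE f0 g0 addr0.
by rewrite (diffD fd gd) /= fw gw addr0.
Qed.

(** Flat functions form a module over the functions continuous at [z]: because [f z = 0], the
    multiplier [g] only scales the differential of [f] by [g z]. *)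
Lemma flat_atM (R : realType) (E : normedModType R) (z w : E) (f g : E -> R) :
  flat_at z w f -> {for z, continuous g} -> flat_at z w (f * g).
Proof.
move=> [fd f0 fw] gc; have [fgd fgE] := is_diff_mul0 fd f0 gc.
split; [exact: fgd|by rewrite fctE f0 mul0r|].
by rewrite fgE fctE fw scaler0.
Qed.

Lemma near_flat_at (R : realType) (E : normedModType R) (z w : E)
    (f g : E -> R) :
  {near z, f =1 g} -> flat_at z w f -> flat_at z w g.
Proof.
move=> fg [fd f0 fw]; have [gd gE] := near_eq_is_diff fg (differentiableP fd).
split; [exact: gd| |by rewrite gE fw].
by rewrite -(nbhs_singleton fg) f0.
Qed.

Lemma flat_at_sum (R : realType) (E : normedModType R) (z w : E) (I : Type)
    (r : seq I) (P : pred I) (f : I -> E -> R) :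
  (forall i, P i -> flat_at z w (f i)) ->
  flat_at z w (fun x => \sum_(i <- r | P i) f i x).
Proof.
move=> ff; rewrite -fct_sumE; apply: (big_ind (flat_at z w)).
- exact: flat_at0.
- by move=> f1 f2; exact: flat_atD.
- exact: ff.
Qed.

(** Differentiability is asked of [f - g] alone, so that Jacobian entries known only to be
    continuous can be compared. The continuity of [g], and with it that of [f], allows both to act
    as multipliers in [flat_atM]. *)
Definition congr_at (R : realType) (E : normedModType R) (z w : E)
    (f g : E -> R) :=
  {for z, continuous g} /\ flat_at z w (f - g).

Lemma congr_at_continuousl (R : realType) (E : normedModType R) (z w : E)
    (f g : E -> R) :
  congr_at z w f g -> {for z, continuous f}.
Proof.
move=> [gc [/differentiable_continuous fgc _ _]].
by rewrite -(subrK g f); exact: continuousD.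
Qed.

Lemma congr_at_cst (R : realType) (E : normedModType R) (z w : E) (a : R) :
  congr_at z w (cst a) (cst a).
Proof.
split; first exact: cst_continuous.
by rewrite subrr; exact: flat_at0.
Qed.

Lemma congr_atD (R : realType) (E : normedModType R) (z w : E)
    (f f' g g' : E -> R) :
  congr_at z w f f' -> congr_at z w g g' -> congr_at z w (f + g) (f' + g').
Proof.
move=> [f'c ff'] [g'c gg']; split; first exact: continuousD.
by rewrite opprD (addrACA f); exact: flat_atD.
Qed.

Lemma congr_atM (R : realType) (E : normedModType R) (z w : E)
    (f f' g g' : E -> R) :
  congr_at z w f f' -> congr_at z w g g' -> congr_at z w (f * g) (f' * g').
Proof.
move=> ff' gg'; have gc := congr_at_continuousl gg'.
move: ff' gg' => [f'c ff'] [g'c gg']; split; first exact: continuousM.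
(* Each summand is a flat difference times a function continuous at [z]. *)
rewrite (_ : _ - _ = (f - f') * g + (g - g') * f').
  by apply: flat_atD; exact: flat_atM.
by rewrite [(g - g') * _]mulrC mulrBl mulrBr addrA subrK.
Qed.

Lemma congr_at_sum (R : realType) (E : normedModType R) (z w : E) (I : Type)
    (r : seq I) (f g : I -> E -> R) :
  (forall i, congr_at z w (f i) (g i)) ->
  congr_at z w (fun x => \sum_(i <- r) f i x) (fun x => \sum_(i <- r) g i x).
Proof.
move=> fg; rewrite -!fct_sumE; apply: (big_ind2 (congr_at z w)).
- exact: (congr_at_cst _ _ 0).
- by move=> f1 f2 g1 g2; exact: congr_atD.
- by move=> i _; exact: fg.
Qed.

Lemma congr_at_prod (R : realType) (E : normedModType R) (z w : E) (I : Type)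
    (r : seq I) (f g : I -> E -> R) :
  (forall i, congr_at z w (f i) (g i)) ->
  congr_at z w (fun x => \prod_(i <- r) f i x) (fun x => \prod_(i <- r) g i x).
Proof.
move=> fg; rewrite -!fct_prodE; apply: (big_ind2 (congr_at z w)).
- exact: (congr_at_cst _ _ 1).
- by move=> f1 f2 g1 g2; exact: congr_atM.
- by move=> i _; exact: fg.
Qed.

Lemma congr_at_mxtrace (R : realType) (E : normedModType R) (z w : E) (n : nat)
    (A B : E -> 'M[R]_n) :
  (forall i j, congr_at z w (fun x => A x i j) (fun x => B x i j)) ->
  congr_at z w (fun x => \tr (A x)) (fun x => \tr (B x)).
Proof. by move=> AB; exact: congr_at_sum. Qed.

Lemma congr_at_det (R : realType) (E : normedModType R) (z w : E) (n : nat)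
    (A B : E -> 'M[R]_n) :
  (forall i j, congr_at z w (fun x => A x i j) (fun x => B x i j)) ->
  congr_at z w (fun x => \det (A x)) (fun x => \det (B x)).
Proof.
(* The determinant is treated as its Leibniz sum: constant signs times products of entries. *)
move=> AB; apply: congr_at_sum => s.
by apply: congr_atM; [exact: congr_at_cst|exact: congr_at_prod].
Qed.

(** * Differentiation rules for traces, determinants, composites and components *)

Lemma differentiable_mxtrace (R : realType) (E : normedModType R) (z : E)
    (n : nat) (A : E -> 'M[R]_n) :
  (forall i j, differentiable (fun x => A x i j) z) ->
  differentiable (fun x => \tr (A x)) z.
Proof.
by move=> Ad; rewrite /mxtrace -fct_sumE; exact: differentiable_sum.
Qed.

Lemma differentiable_det (R : realType) (E : normedModType R) (z : E)
    (n : nat) (A : E -> 'M[R]_n) :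
  (forall i j, differentiable (fun x => A x i j) z) ->
  differentiable (fun x => \det (A x)) z.
Proof.
move=> Ad; rewrite /determinant -fct_sumE.
apply: (big_ind (fun f : E -> R => differentiable f z)) => [||s _].
  exact: (differentiable_cst (0 : R) z).
  by move=> *; exact: differentiableD.
apply: differentiableM; first exact: differentiable_cst.
rewrite -fct_prodE; apply: (big_ind (fun f : E -> R => differentiable f z)).
- exact: (differentiable_cst (1 : R) z).
- by move=> f g; exact: differentiableM.
- by move=> i _; exact: Ad.
Qed.

Lemma is_diff_compE (R : realType) (E F G : normedModType R) (f : E -> F)
    (g : F -> G) (x : E) :
  differentiable f x -> differentiable g (f x) ->
  is_diff x (fun y => g (f y)) (fun v => 'd g (f x) ('d f x v)).
Proof.
by move=> fd gd; exact: is_diff_comp (differentiableP fd) (differentiableP gd).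
Qed.

Lemma is_diffME (R : realType) (E : normedModType R) (f g df dg : E -> R)
    (x : E) :
  is_diff x f df -> is_diff x g dg ->
  is_diff x (fun y => f y * g y) (fun v => f x * dg v + g x * df v).
Proof. exact: is_diffM. Qed.

Lemma is_diff_coord (R : realType) (E : normedModType R) (m n : nat)
    (f df : E -> 'M[R]_(m.+1, n.+1)) (x : E) i j :
  is_diff x f df -> is_diff x (fun y => f y i j) (fun v => df v i j).
Proof.
move=> [fd <-]; apply: DiffDef; first exact: differentiable_coordf.
by apply/funext => v; exact: diff_coord.
Qed.

Lemma jacobian_coord (R : realType) (m n : nat)
    (f : 'rV[R]_m.+1 -> 'rV[R]_n.+1) (x : 'rV[R]_m.+1) i j :
  differentiable f x -> 'J f x i j = 'd (fun y => f y 0 j) x (delta_mx 0 i).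
Proof. by move=> fd; rewrite diff_coord// mxE. Qed.

Lemma diff_delta (R : realType) (m n : nat)
    (f : 'rV[R]_m.+1 -> 'rV[R]_n.+1) (x : 'rV[R]_m.+1) i :
  'd f x (delta_mx 0 i) = row i ('J f x).
Proof. by rewrite diff_mulmx_jacobian -rowE. Qed.

(** Assembles a Jacobian from the differentials of the components, which is how the one of the
    pulled-back field is computed. *)
Lemma jacobian_is_diff (R : realType) (m n : nat)
    (f : 'rV[R]_m.+1 -> 'rV[R]_n.+1) (df : 'I_n.+1 -> 'rV[R]_m.+1 -> R)
    (x : 'rV[R]_m.+1) :
  (forall j, is_diff x (fun y => f y 0 j) (df j)) ->
  differentiable f x /\ 'J f x = \matrix_(i, j) df j (delta_mx 0 i).
Proof.
move=> fjd; have fd : differentiable f x.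
  by apply: differentiable_rV => j; case: (fjd j).
split; first exact: fd.
apply/matrixP => i j; rewrite [RHS]mxE; have [_ fjE] := fjd j.
by rewrite -fjE; exact: jacobian_coord.
Qed.

Lemma diff_comp_delta (R : realType) (m n q : nat)
    (f : 'rV[R]_m.+1 -> 'rV[R]_n.+1) (h : 'rV[R]_n.+1 -> 'rV[R]_q.+1)
    (x : 'rV[R]_m.+1) (y : 'rV[R]_n.+1) i j :
  'd h y ('d f x (delta_mx 0 i)) 0 j = ('J f x *m 'J h y) i j.
Proof. by rewrite diff_delta diff_mulmx_jacobian -row_mul mxE. Qed.

Lemma sum_continuous_at (R : realType) (T : topologicalType)
    (E : normedModType R) (I : Type) (r : seq I) (f : I -> T -> E) (x : T) :
  (forall i, {for x, continuous (f i)}) ->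
  {for x, continuous (\sum_(i <- r) f i)}.
Proof.
move=> fc; apply: (big_ind (fun f : T -> E => {for x, continuous f})).
- exact: cst_continuous.
- by move=> f1 f2; exact: continuousD.
- by move=> i _; exact: fc.
Qed.

(** * Transfer of derivatives through congruence, and continuity of products *)

Lemma near_congr_at (R : realType) (E : normedModType R) (z w : E)
    (f g h : E -> R) :
  {near z, g =1 h} -> congr_at z w f g -> congr_at z w f h.
Proof.
move=> gh [gc fg]; split.
  rewrite /prop_for /continuous_at -(nbhs_singleton gh).
  by apply: cvg_trans gc; exact: near_eq_cvg.
by apply: near_flat_at fg; apply: filterS gh => x ghx; rewrite !fctE ghx.
Qed.

(** Here [f] is a flat function plus [g \o phi], so it inherits differentiability at [z], and along
    [w] only the chain-rule term survives. *)
Lemma congr_at_comp (R : realType) (E F : normedModType R) (z w : E)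
    (phi : E -> F) (f : E -> R) (g : F -> R) :
  differentiable phi z -> differentiable g (phi z) ->
  congr_at z w f (fun x => g (phi x)) ->
  differentiable f z /\ 'd f z w = 'd g (phi z) ('d phi z w).
Proof.
move=> phid gd [_ [fgd _ fgw]]; have [gphid gphiE] := is_diff_compE phid gd.
rewrite -(subrK (fun x => g (phi x)) f); split; first exact: differentiableD.
by rewrite (diffD fgd gphid) -[LHS]/(_ + _) fgw gphiE add0r.
Qed.

Lemma CkW (R : realType) (E F : normedModType R) (k : nat) (U : set E)
    (f : E -> F) :
  Ck k.+1 U f -> Ck k U f.
Proof.
elim: k f => [|k IH] f [fd fD].
  by move=> x /fd; exact: differentiable_continuous.
by split=> // v; apply: IH; exact: fD.
Qed.

Lemma Ck_subset (R : realType) (E F : normedModType R) (k : nat) (U V : set E)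
    (f : E -> F) :
  V `<=` U -> Ck k U f -> Ck k V f.
Proof.
move=> VU; elim: k f => [|k IH] f; first by move=> fc x /VU; exact: fc.
by case=> fd fD; split=> [x /VU|v]; [exact: fd|exact/IH/fD].
Qed.

Lemma continuous_at_dotv (R : realType) (T : topologicalType) (n : nat)
    (u v : T -> 'rV[R]_n) (x : T) :
  (forall i, {for x, continuous (fun y => u y 0 i)}) ->
  (forall i, {for x, continuous (fun y => v y 0 i)}) ->
  {for x, continuous (fun y => dotv (u y) (v y))}.
Proof.
move=> uc vc; rewrite /dotv -fct_sumE; apply: sum_continuous_at => i.
by apply: continuousM; [exact: uc|exact: vc].
Qed.

Lemma continuous_at_mulmx (R : realType) (T : topologicalType) (m n q : nat)
    (A : T -> 'M[R]_(m, n)) (B : T -> 'M[R]_(n, q)) (x : T) :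
  (forall i j, {for x, continuous (fun y => A y i j)}) ->
  (forall i j, {for x, continuous (fun y => B y i j)}) ->
  forall i j, {for x, continuous (fun y => (A y *m B y) i j)}.
Proof.
move=> Ac Bc i j.
rewrite (_ : (fun y => _) = fun y => \sum_k A y i k * B y k j); last first.
  by apply/funext => y; rewrite mxE.
rewrite -fct_sumE; apply: sum_continuous_at => k.
by apply: continuousM; [exact: Ac|exact: Bc].
Qed.

Lemma Ck_grad (R : realType) (n k : nat) (U : set 'rV[R]_n.+1)
    (f : 'rV[R]_n.+1 -> R) i :
  Ck k.+1 U f -> Ck k U (fun x => grad f x 0 i).
Proof.
move=> [_ fD].
rewrite (_ : (fun x => _) = 'D_(delta_mx 0 i) f); first exact: fD.
by apply/funext => x; rewrite mxE.
Qed.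

Lemma congr_at_comp_grad (R : realType) (m n : nat)
    (phi : 'rV[R]_m.+1 -> 'rV[R]_n.+1) (f : 'rV[R]_m.+1 -> R)
    (g : 'rV[R]_n.+1 -> R) (z w : 'rV[R]_m.+1) :
  differentiable phi z -> differentiable g (phi z) ->
  congr_at z w f (fun x => g (phi x)) ->
  differentiable f z /\
  dotv (grad f z) w = dotv (grad g (phi z)) (w *m 'J phi z).
Proof.
move=> phid gd fg; have [fd fE] := congr_at_comp phid gd fg.
by rewrite (dotv_grad _ fd) fE (dotv_grad _ gd) diff_mulmx_jacobian.
Qed.

Lemma is_diff_sum (R : realType) (E F : normedModType R) (z : E) (I : Type)
    (r : seq I) (f df : I -> E -> F) :
  (forall i, is_diff z (f i) (df i)) ->
  is_diff z (fun x => \sum_(i <- r) f i x) (fun v => \sum_(i <- r) df i v).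
Proof.
move=> fd; rewrite -!fct_sumE.
apply: (big_ind2 (fun f df : E -> F => is_diff z f df)).
- exact: (is_diff_cst (0 : F) z).
- by move=> f1 df1 f2 df2 fd1 fd2; exact: is_diffD.
- by move=> i _; exact: fd.
Qed.

(** * The pulled-back field and its Jacobian *)

Lemma jacobian_cancel (R : realType) (n : nat)
    (phi g : 'rV[R]_n.+1 -> 'rV[R]_n.+1) (z : 'rV[R]_n.+1) :
  differentiable phi z -> differentiable g (phi z) ->
  (\near z, g (phi z) = z) -> 'J phi z *m 'J g (phi z) = 1%:M.
Proof.
move=> phid gd gK; apply/row_matrixP => i; rewrite !rowE mulmxA mulmx1.
rewrite -!diff_mulmx_jacobian.
have [_ idE] : is_diff z id ('d g (phi z) \o 'd phi z).
  apply: (near_eq_is_diff (f := g \o phi)) => //.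
  exact: (is_diff_comp (differentiableP phid) (differentiableP gd)).
by rewrite -[LHS]/(('d g (phi z) \o 'd phi z) _) -idE diff_val.
Qed.

(** Trades the matrix inverse for the Jacobian of [g], whose entries can be differentiated by the
    chain rule. *)
Lemma pullback_fieldE (R : realType) (n : nat)
    (phi g X : 'rV[R]_n.+1 -> 'rV[R]_n.+1) (z : 'rV[R]_n.+1) :
  differentiable phi z -> differentiable g (phi z) ->
  (\near z, g (phi z) = z) ->
  pullback_field phi X z = X (phi z) *m 'J g (phi z).
Proof.
move=> phid gd gK; have phig1 := jacobian_cancel phid gd gK.
have [phiu _] := mulmx1_unit phig1; rewrite /pullback_field; congr (_ *m _).
by rewrite -[LHS]mulmx1 -phig1 mulKmx.
Qed.

(** Product rule on the components of [X (phi z) *m 'J g (phi z)]. Second derivatives fall on [g]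
    rather than on [phi], and come multiplied by components of [X (phi z)]. *)
Lemma jacobian_pullback_field (R : realType) (n : nat)
    (phi g X : 'rV[R]_n.+1 -> 'rV[R]_n.+1) (z : 'rV[R]_n.+1) :
  differentiable phi z -> differentiable X (phi z) ->
  (forall k j, differentiable (fun y => 'J g y k j) (phi z)) ->
  (\near z, pullback_field phi X z = X (phi z) *m 'J g (phi z)) ->
  differentiable (pullback_field phi X) z /\
  'J (pullback_field phi X) z =
    'J phi z *m 'J X (phi z) *m 'J g (phi z) +
    \matrix_(i, j) \sum_k X (phi z) 0 k *
      dotv (grad (fun y => 'J g y k j) (phi z)) (row i ('J phi z)).
Proof.
move=> phid Xd gd YE; set Y := pullback_field phi X.
have Yjd j : is_diff z (fun x => Y x 0 j) (fun v => \sum_k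
    (X (phi z) 0 k * 'd (fun y => 'J g y k j) (phi z) ('d phi z v) +
     'J g (phi z) k j * 'd X (phi z) ('d phi z v) 0 k)).
  apply: (near_eq_is_diff
    (f := fun x => \sum_k X (phi x) 0 k * 'J g (phi x) k j)).
    by apply: filterS YE => x; rewrite /Y => ->; rewrite mxE.
  apply: is_diff_sum => k; apply: is_diffME.
    exact: (is_diff_coord 0 k (is_diff_compE phid Xd)).
  exact: (is_diff_compE (g := fun y => 'J g y k j) phid (gd k j)).
have [Yd JE] := jacobian_is_diff Yjd; split; first exact: Yd.
rewrite JE; apply/matrixP => i j.
(* The terms in which [X] is differentiated sum to the triple product, those in which ['J g] is
   differentiated to the correction. *)
rewrite [LHS]mxE [RHS]mxE big_split [LHS]addrC; congr (_ + _).
  rewrite [RHS]mxE; apply: eq_bigr => k _; rewrite mulrC; congr (_ * _).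
  exact: diff_comp_delta.
rewrite [RHS]mxE; apply: eq_bigr => k _; congr (_ * _).
exact: etrans (congr1 _ (diff_delta phi z i)) (esym (dotv_grad _ (gd k j))).
Qed.

(** Only [g] is differentiated twice, inside the correction term; being C^2, it supplies the
    continuous multipliers for [flat_atM]. *)
Lemma jacobian_pullback_congr (R : realType) (n : nat) (V W : set 'rV[R]_n.+1)
    (phi g X : 'rV[R]_n.+1 -> 'rV[R]_n.+1) (z w : 'rV[R]_n.+1) :
  open V -> open W -> Ck 1 V phi -> Ck 1 W X -> Ck 2 W g ->
  (forall x, V x -> W (phi x)) -> (forall x, V x -> g (phi x) = x) ->
  V z -> X (phi z) = 0 -> w *m 'J phi z *m 'J X (phi z) = 0 ->
  forall i j, congr_at z w (fun x => 'J (pullback_field phi X) x i j)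
    (fun x => ('J phi x *m 'J X (phi x) *m 'J g (phi x)) i j).
Proof.
move=> Vo Wo phiC XC gC VW gK Vz Xz0 wX i j.
have Vnbhs x : V x -> nbhs x V by move=> Vx; exact: open_nbhs_nbhs.
have phid x : V x -> differentiable phi x by case: phiC => + _; apply.
have Xd x : V x -> differentiable X (phi x).
  by move=> Vx; case: XC => + _; apply; exact: VW.
have gd x : V x -> differentiable g (phi x).
  by move=> Vx; case: gC => + _; apply; exact: VW.
have JgC k l : Ck 1 W (fun y => 'J g y k l) := Ck_jacobian k l Wo gC.
have Jgd k l x : V x -> differentiable (fun y => 'J g y k l) (phi x).
  by move=> Vx; case: (JgC k l) => + _; apply; exact: VW.
have YE x : V x -> pullback_field phi X x = X (phi x) *m 'J g (phi x).
  move=> Vx; apply: pullback_fieldE; [exact: phid|exact: gd|].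
  by apply: filterS (Vnbhs x Vx) => y; exact: gK.
have phic : {for z, continuous phi} := Ck_continuous phiC Vz.
have Wphiz := VW z Vz.
have Jphic k l : {for z, continuous (fun x => 'J phi x k l)}.
  exact: Ck_continuous (Ck_jacobian k l Vo phiC) Vz.
have JXc k l : {for z, continuous (fun x => 'J X (phi x) k l)}.
  apply: (continuous_comp (g := fun y => 'J X y k l)) => //.
  exact: Ck_continuous (Ck_jacobian k l Wo XC) Wphiz.
have Jgc k l : {for z, continuous (fun x => 'J g (phi x) k l)}.
  apply: (continuous_comp (g := fun y => 'J g y k l)) => //.
  exact: Ck_continuous (JgC k l) Wphiz.
split.
  exact: (continuous_at_mulmx (continuous_at_mulmx Jphic JXc) Jgc).
(* The Jacobian formula holds at every point of [V], so the difference of entries equals the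
   correction on a whole neighbourhood of [z]. *)
apply: (near_flat_at (f := fun x => \sum_k X (phi x) 0 k *
    dotv (grad (fun y => 'J g y k j) (phi x)) (row i ('J phi x)))).
  apply: filterS (Vnbhs z Vz) => x Vx; rewrite fctE.
  have [|_ ->] := jacobian_pullback_field (phid x Vx) (Xd x Vx)
    (fun k l => Jgd k l x Vx).
    by apply: filterS (Vnbhs x Vx) => y; exact: YE.
  by rewrite [X in _ = X - _]mxE [RHS]addrC addKr [RHS]mxE.
apply: flat_at_sum => k _; apply: flat_atM.
  (* Each component of [X \o phi] is flat: its derivative along [w] is an entry of
     [w *m 'J phi z *m 'J X (phi z)]. *)
  have [Xkd XkE] := is_diff_coord 0 k (is_diff_compE (phid z Vz) (Xd z Vz)).
  split; [exact: Xkd|by rewrite Xz0 mxE|].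
  by rewrite XkE !diff_mulmx_jacobian wX mxE.
apply: continuous_at_dotv => l; last first.
  rewrite (_ : (fun x => _) = fun x => 'J phi x i l); first exact: Jphic.
  by apply/funext => x; rewrite [LHS]mxE.
apply: (continuous_comp (g := fun y => grad (fun y => 'J g y k j) y 0 l)) => //.
exact: Ck_continuous (Ck_grad l (JgC k j)) Wphiz.
Qed.

(** * Invariance of the directional derivatives of trace and determinant *)

Theorem lemma2p5 (R : realType) (U V W : set 'rV[R]_2)
    (X phi : 'rV[R]_2 -> 'rV[R]_2) (p q0 z0 : 'rV[R]_2)
    (U_open : open U) (X_C2 : Ck 2 U X) (Up : U p) (Xp : X p = 0)
    (DXp_nilpotent : nilpotent_mx ('J X p)) (DXp_rank : \rank ('J X p) = 1%N)
    (q0_ker : (q0 == kermx ('J X p))%MS)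
    (phi_diffeo : Ck_diffeo 2 V W phi) (WU : W `<=` U)
    (Vz0 : V z0) (phi_z0 : phi z0 = p) :
  let Y := pullback_field phi X in
  let q0z := q0 *m invmx ('J phi z0) in
  [/\ differentiable (trD Y) z0,
      differentiable (detD Y) z0,
      dotv (grad (trD Y) z0) q0z = dotv (grad (trD X) p) q0 &
      dotv (grad (detD Y) z0) q0z = dotv (grad (detD X) p) q0].
Proof.
move=> Y q0z; case: phi_diffeo => Vo Wo phiC2 phiVW [g [gC2 gK]].
have VW x : V x -> W (phi x) by rewrite -phiVW; exists x.
have phiC : Ck 1 V phi by exact: CkW phiC2.
have XC : Ck 1 W X by apply: CkW; exact: Ck_subset WU X_C2.
have phid x : V x -> differentiable phi x by case: phiC => + _; apply.
have gd x : V x -> differentiable g (phi x).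
  by move=> Vx; case: gC2 => + _; apply; exact: VW.
have Vnbhs x : V x -> nbhs x V by move=> Vx; exact: open_nbhs_nbhs.
have phigE x : V x -> 'J phi x *m 'J g (phi x) = 1%:M.
  move=> Vx; apply: jacobian_cancel; [exact: phid|exact: gd|].
  by apply: filterS (Vnbhs x Vx) => y; exact: gK.
have [phiu _] := mulmx1_unit (phigE z0 Vz0).
(* The differential of [phi] carries [q0z] back to [q0], so flatness along [q0z] reduces to the
   kernel condition on [q0]. *)
have q0zE : q0z *m 'J phi z0 = q0 := mulmxKV phiu q0.
have q0X : q0 *m 'J X p = 0 by apply/sub_kermxP; case/andP: q0_ker.
(* The full C^2 class of [X] is used here, to make [trD X] and [detD X] differentiable at [p]. *)
have JXd i j : differentiable (fun y => 'J X y i j) (phi z0).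
  rewrite phi_z0; case: (Ck_jacobian i j U_open X_C2) => + _; exact.
have YX := @jacobian_pullback_congr _ _ V W phi g X z0 q0z Vo Wo phiC XC gC2
  VW gK Vz0.
rewrite q0zE phi_z0 in YX; have {}YX := YX Xp q0X.
have tr_congr : congr_at z0 q0z (trD Y) (fun x => trD X (phi x)).
  apply: near_congr_at (congr_at_mxtrace YX).
  (* Cyclicity of the trace brings ['J g] in front of ['J phi]; for square matrices the inverse
     relation [phigE] also holds in that order. *)
  apply: filterS (Vnbhs z0 Vz0) => x Vx; rewrite mxtrace_mulC mulmxA.
  by rewrite (mulmx1C (phigE x Vx)) mul1mx.
have det_congr : congr_at z0 q0z (detD Y) (fun x => detD X (phi x)).
  apply: near_congr_at (congr_at_det YX).
  (* The determinants of the two outer factors commute past the middle one and multiply to 1. *)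
  apply: filterS (Vnbhs z0 Vz0) => x Vx; rewrite !det_mulmx mulrAC -det_mulmx.
  by rewrite (phigE x Vx) det1 mul1r.
have trXd : differentiable (trD X) (phi z0) by exact: differentiable_mxtrace.
have detXd : differentiable (detD X) (phi z0) by exact: differentiable_det.
have [trYd trYE] := congr_at_comp_grad (phid z0 Vz0) trXd tr_congr.
have [detYd detYE] := congr_at_comp_grad (phid z0 Vz0) detXd det_congr.
rewrite -phi_z0; split; [exact: trYd|exact: detYd| |].
- by rewrite -q0zE.
- by rewrite -q0zE.
Qed.
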